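(* Let $f:\mathbb{R}^n\times\mathbb{R}^m\to\mathbb{R}^n$ be continuous, let $\mathbb{Y}\subseteq\mathbb{R}^n\times\mathbb{R}^m$ be a non-empty constraint set, let $\ell_1,\ell_2:\mathbb{Y}\to\mathbb{R}$ be stage costs, and let $[\underline{\mu},\overline{\mu}]\subseteq[0,1]$. Assume that the system $x(k+1)=f(x(k),u(k))$ is strictly dissipative for the cost function $\ell_\mu=\mu\ell_1+(1-\mu)\ell_2$ for all $\mu\in[\underline{\mu},\overline{\mu}]$, and assume that the corresponding optimal equilibria $(x_\mu^e,u_\mu^e)$ (the equilibria at which strict dissipativity holds for $\ell_\mu$) are contained in a compact set $\widehat{\mathbb{Y}}\subset\mathbb{Y}$. Then the map $$\mu\mapsto x_\mu^e$$ is continuous on $[\underline{\mu},\overline{\mu}]$.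
   Context: Let $\mathbb{X}:=\{x\in\mathbb{R}^n : \text{there is } u\in\mathbb{R}^m \text{ with } (x,u)\in\mathbb{Y}\}$. An equilibrium is a pair $(x^e,u^e)\in\mathbb{Y}$ with $x^e=f(x^e,u^e)$. $\|\cdot\|$ is an arbitrary norm on $\mathbb{R}^n$. $\mathcal{K}_\infty$ is the set of continuous, strictly increasing, unbounded functions $\alpha:[0,\infty)\to[0,\infty)$ with $\alpha(0)=0$. The system is strictly dissipative for the stage cost $\ell$ at an equilibrium $(x^e,u^e)$ if there exist a storage function $\lambda:\mathbb{X}\to\mathbb{R}$, bounded on bounded subsets of $\mathbb{X}$ and bounded from below on $\mathbb{X}$, and $\alpha\in\mathcal{K}_\infty$ such that for all $(x,u)\in\mathbb{Y}$ with $f(x,u)\in\mathbb{X}$ $$\ell(x,u)-\ell(x^e,u^e)+\lambda(x)-\lambda(f(x,u))\ge\alpha(\|x-x^e\|).$$ If no equilibrium is named, the property is meant at some equilibrium. Storage function, $\alpha$ and equilibrium may depend on $\mu$ when $\ell=\ell_\mu$. *)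

(* Defs.v *)
From HB Require Import structures.
From mathcomp Require Import all_boot all_order all_algebra.
From mathcomp Require Import all_classical all_reals all_analysis.

Set Implicit Arguments.
Unset Strict Implicit.
Unset Printing Implicit Defensive.

Import Order.TTheory GRing.Theory Num.Theory.
Import numFieldNormedType.Exports.

Local Open Scope classical_set_scope.
Local Open Scope ring_scope.

(* Points of R^n and R^m are row vectors; their topology is the usual one
   (that of the max norm).  The arbitrary norm on R^n is a function N satisfying
   [is_norm N], independent of the library norm `|_|.
   Functions defined on a subset (stage costs on Y, storage functions on X,
   comparison functions on [0, +oo[) are total functions of which only the
   values on that subset are used. *)

Record is_norm (R : realType) (n : nat) (N : 'rV[R]_n -> R) : Prop := IsNorm {
  is_norm_triangle : forall x y, N (x + y) <= N x + N y;
  is_norm_scale : forall (a : R) x, N (a *: x) = `|a| * N x;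
  is_norm_eq0 : forall x, N x = 0 -> x = 0
}.

Record class_K_infty (R : realType) (alpha : R -> R) : Prop := ClassKInfty {
  K_infty_nonneg : forall r, 0 <= r -> 0 <= alpha r;
  K_infty_continuous : {within `[0, +oo[%classic, continuous alpha};
  K_infty_increasing : forall r s, 0 <= r -> r < s -> alpha r < alpha s;
  K_infty_unbounded : forall M, exists2 r, 0 <= r & M < alpha r;
  K_infty_zero : alpha 0 = 0
}.

Section Dissipativity.
Context (R : realType) (n m : nat).
Implicit Types (f : 'rV[R]_n * 'rV[R]_m -> 'rV[R]_n)
  (Y : set ('rV[R]_n * 'rV[R]_m)) (l : 'rV[R]_n * 'rV[R]_m -> R).

Definition state_constraints Y : set 'rV[R]_n := [set x | exists u, Y (x, u)].

Definition equilibrium f Y (xe : 'rV[R]_n) (ue : 'rV[R]_m) : Prop :=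
  Y (xe, ue) /\ xe = f (xe, ue).

(* Boundedness of subsets is that of the max norm; all norms on R^n have the
   same bounded sets. *)
Definition storage_function Y (lambda : 'rV[R]_n -> R) : Prop :=
  (forall B : set 'rV[R]_n, B `<=` state_constraints Y -> bounded_set B ->
     [bounded lambda x | x in B]) /\
  has_lbound (lambda @` state_constraints Y).

Definition strictly_dissipative_at (N : 'rV[R]_n -> R) f Y l
    (xe : 'rV[R]_n) (ue : 'rV[R]_m) : Prop :=
  equilibrium f Y xe ue /\
  exists lambda : 'rV[R]_n -> R, storage_function Y lambda /\
  exists alpha : R -> R, class_K_infty alpha /\
  forall x u, Y (x, u) -> state_constraints Y (f (x, u)) ->
    l (x, u) - l (xe, ue) + lambda x - lambda (f (x, u)) >= alpha (N (x - xe)).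

Definition weighted_cost (l1 l2 : 'rV[R]_n * 'rV[R]_m -> R) (mu : R)
    : 'rV[R]_n * 'rV[R]_m -> R :=
  fun z => mu * l1 z + (1 - mu) * l2 z.

End Dissipativity.

(* Main.v *)
Require Import Defs.
From HB Require Import structures.
From mathcomp Require Import all_boot all_order all_algebra.
From mathcomp Require Import all_classical all_reals all_analysis.
From mathcomp Require Import lra.

Set Implicit Arguments.
Unset Strict Implicit.
Unset Printing Implicit Defensive.

Import Order.TTheory GRing.Theory Num.Theory.
Import numFieldNormedType.Exports.

Local Open Scope classical_set_scope.
Local Open Scope ring_scope.

(** The optimal equilibrium at [mu] minimizes the cost [l_mu] among all
    equilibria: an equilibrium is a constant trajectory, so the storage terms
    cancel in the dissipation inequality and what remains is
    [l_mu z - l_mu z_mu >= alpha_mu (N (x - x_mu))] for every equilibrium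
    [z = (x, u)] (lemma [strictly_dissipative_equilibrium_cost]).

    Write [z_mu] for the optimal equilibrium at [mu] and [d := l1 - l2], so that
    [l_mu = l2 + mu d]. Comparing [z_mu] and [z_nu] in both directions and
    adding, with the nonnegative [alpha_nu] term dropped, gives
    [alpha_mu (N (x_nu - x_mu)) <= (mu - nu) (d z_nu - d z_mu)]
    (lemma [equilibrium_gap_le]). The left-hand side is nonnegative, hence
    [d z_mu] is nonincreasing in [mu], so on the closed interval it stays between
    its two endpoint values. Thus the right-hand side is
    at most [|mu - nu|] times a constant, and it tends to 0 as [nu] tends to
    [mu]. Since [alpha_mu] is increasing and vanishes at 0, [N (x_nu - x_mu)]
    tends to 0, and the equivalence of [N] with the max norm (lemma
    [norm_lower_bound]) turns this into convergence of [x_nu] to [x_mu]. *)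

(** * Norms on row vectors *)

Section Norms.
Context (R : realType) (n : nat) (N : 'rV[R]_n -> R) (HN : is_norm N).

Lemma norm0 : N 0 = 0.
Proof. by rewrite -(scale0r 0) (is_norm_scale HN) normr0 mul0r. Qed.

Lemma normN x : N (- x) = N x.
Proof. by rewrite -scaleN1r (is_norm_scale HN) normrN1 mul1r. Qed.

Lemma norm_ge0 x : 0 <= N x.
Proof.
have := is_norm_triangle HN x (- x).
by rewrite subrr norm0 normN; lra.
Qed.

Lemma norm_dist x y : `|N x - N y| <= N (x - y).
Proof.
have := is_norm_triangle HN (x - y) y; rewrite subrK => Hx.
have := is_norm_triangle HN (y - x) x; rewrite subrK -opprB normN => Hy.
by rewrite ler_norml; lra.
Qed.

Lemma norm_sum (I : Type) (s : seq I) (F : I -> 'rV[R]_n) :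
  N (\sum_(i <- s) F i) <= \sum_(i <- s) N (F i).
Proof.
elim/big_ind2: _ => [|x a y b Hx Hy|//]; first by rewrite norm0.
exact: le_trans (is_norm_triangle HN _ _) (lerD Hx Hy).
Qed.

Lemma norm_upper_bound : exists2 C, 0 < C & forall x, N x <= C * `|x|.
Proof.
exists (1 + \sum_(j < n) N (delta_mx 0 j)).
  by rewrite ltr_pwDl// sumr_ge0// => j _; exact: norm_ge0.
move=> x; rewrite {1}[x]row_sum_delta.
apply: (le_trans (norm_sum _ _)); rewrite mulrDl mul1r mulr_suml.
rewrite ler_wpDl//; apply: ler_sum => j _.
rewrite (is_norm_scale HN) mulrC ler_wpM2l ?norm_ge0//.
rewrite [leRHS]/Num.norm /= mx_normrE; apply/bigmax_geP; right => /=.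
by exists (0, j).
Qed.

Lemma is_norm_continuous : continuous N.
Proof.
have [C C0 HC] := norm_upper_bound.
move=> x; apply/(@cvgrPdist_lt R R^o _ (nbhs x) (nbhs_filter x) N) => e e0.
near=> y; apply: le_lt_trans (norm_dist x y) _.
apply: le_lt_trans (HC _) _; rewrite mulrC -ltr_pdivlMr//.
near: y; apply/(@nbhs_normP R 'rV[R]_n); exists (e / C) => //=; exact: divr_gt0.
Unshelve. all: by end_near.
Qed.

(** The unit sphere of the max norm is compact, so [N] attains on it a minimum,
    which is positive because [N] vanishes only at 0; homogeneity does the
    rest. *)
Lemma norm_lower_bound : exists2 c, 0 < c & forall x, c * `|x| <= N x.
Proof.
(* The sphere is empty when [n = 0]; any constant then works. *)
have [[x0 x0N0]|all0] := pselect (exists x : 'rV[R]_n, x != 0); last first.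
  exists 1 => // x; have -> : x = 0 by apply: contra_notP all0 => /eqP; exists x.
  by rewrite normr0 norm0 mulr0.
pose S := [set x : 'rV[R]_n | `|x| = 1].
have normalized x : x != 0 -> S (`|x|^-1 *: x).
  by move=> xN0; rewrite /S /= normrZ normfV normr_id mulVf// normr_eq0.
have Sc : compact S.
  apply: bounded_closed_compact.
    by exists 1; split=> // M M1 x; rewrite /S /= => ->; exact: ltW.
  apply: (closed_comp (f := fun x : 'rV[R]_n => `|x|) (D := [set 1])).
    by move=> x _; exact: norm_continuous.
  exact: closed_eq.
have [|x /set_mem Sx Nmin] :=
  compact_EVT_min _ Sc (continuous_subspaceT is_norm_continuous).
  by exists (`|x0|^-1 *: x0); exact: normalized.
exists (N x).
  rewrite lt_neqAle norm_ge0 andbT eq_sym; apply/eqP => /(is_norm_eq0 HN) x_eq0.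
  by move: Sx; rewrite /S /= x_eq0 normr0 => /esym/eqP; rewrite oner_eq0.
move=> y; have [->|yN0] := eqVneq y 0; first by rewrite normr0 norm0 mulr0.
have := Nmin _ (mem_set (normalized _ yN0)).
by rewrite (is_norm_scale HN) normfV normr_id mulrC ler_pdivlMr// normr_gt0.
Qed.

End Norms.

(** * Equilibria and strict dissipativity *)

Section Equilibria.
Context (R : realType) (n m : nat) (N : 'rV[R]_n -> R).
Context (f : 'rV[R]_n * 'rV[R]_m -> 'rV[R]_n) (Y : set ('rV[R]_n * 'rV[R]_m)).
Implicit Types l : 'rV[R]_n * 'rV[R]_m -> R.

(** Along the constant trajectory of an equilibrium the storage does not
    change, so the dissipation inequality bounds the cost alone. *)
Lemma strictly_dissipative_equilibrium_cost l xe ue :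
  strictly_dissipative_at N f Y l xe ue ->
  exists2 alpha, class_K_infty alpha &
    forall x u, equilibrium f Y x u ->
      alpha (N (x - xe)) <= l (x, u) - l (xe, ue).
Proof.
move=> [_ [lambda [_ [alpha [Kalpha Hdiss]]]]]; exists alpha => // x u [Yxu fxu].
have := Hdiss x u Yxu; rewrite -fxu addrK; apply.
by exists u.
Qed.

Context (HN : is_norm N) (l1 l2 : 'rV[R]_n * 'rV[R]_m -> R).

(** This is the sum of two cost comparisons at equilibria: that of [(y, v)] with
    the optimum at [mu], and that of [(x, u)] with the optimum at [nu], for
    which only the sign is kept so that [alpha] depends on [mu] alone. The sum
    of the cost differences is the right-hand side because
    [l_mu - l_nu = (mu - nu) (l1 - l2)]. *)
Lemma equilibrium_gap_le mu x u :
  strictly_dissipative_at N f Y (weighted_cost l1 l2 mu) x u ->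
  exists2 alpha, class_K_infty alpha & forall nu y v,
    strictly_dissipative_at N f Y (weighted_cost l1 l2 nu) y v ->
    alpha (N (y - x)) <= (mu - nu) * ((l1 \- l2) (y, v) - (l1 \- l2) (x, u)).
Proof.
move=> Dx; have [alpha Ka Ha] := strictly_dissipative_equilibrium_cost Dx.
exists alpha => // nu y v Dy; have := Ha _ _ Dy.1.
have [beta Kb Hb] := strictly_dissipative_equilibrium_cost Dy.
have := Hb _ _ Dx.1; have := K_infty_nonneg Kb (norm_ge0 HN (x - y)).
by rewrite /weighted_cost /=; lra.
Qed.

Lemma optimal_cost_gap_nonincreasing mu x u nu y v :
  strictly_dissipative_at N f Y (weighted_cost l1 l2 mu) x u ->
  strictly_dissipative_at N f Y (weighted_cost l1 l2 nu) y v ->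
  mu < nu -> (l1 \- l2) (y, v) <= (l1 \- l2) (x, u).
Proof.
move=> Dx Dy mu_nu; have [alpha Ka /(_ _ _ _ Dy)] := equilibrium_gap_le Dx.
move/(le_trans (K_infty_nonneg Ka (norm_ge0 HN (y - x)))).
by rewrite nmulr_rge0 ?subr_lt0// subr_le0.
Qed.

End Equilibria.

(** * Continuity of the optimal equilibrium *)

Theorem theorem4p1 (R : realType) (n m : nat)
  (N : 'rV[R]_n -> R) (HN : is_norm N)
  (f : 'rV[R]_n * 'rV[R]_m -> 'rV[R]_n) (Hf : continuous f)
  (Y : set ('rV[R]_n * 'rV[R]_m)) (HY : Y !=set0)
  (l1 l2 : 'rV[R]_n * 'rV[R]_m -> R)
  (mulo muhi : R) (Hmu : `[mulo, muhi]%classic `<=` `[0, 1]%classic)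
  (xe : R -> 'rV[R]_n) (ue : R -> 'rV[R]_m)
  (Hdiss : forall mu, mulo <= mu <= muhi ->
     strictly_dissipative_at N f Y (weighted_cost l1 l2 mu) (xe mu) (ue mu))
  (Yhat : set ('rV[R]_n * 'rV[R]_m)) (HYhat : compact Yhat)
  (HYhatY : Yhat `<=` Y)
  (Hin : forall mu, mulo <= mu <= muhi -> Yhat (xe mu, ue mu)) :
  {within `[mulo, muhi]%classic, continuous xe}.
Proof.
pose d nu := (l1 \- l2) (xe nu, ue nu).
have d_noninc mu nu : mulo <= mu <= muhi -> mulo <= nu <= muhi -> mu <= nu ->
    d nu <= d mu.
  move=> mu_in nu_in; rewrite le_eqVlt => /predU1P[-> //|].
  exact: (optimal_cost_gap_nonincreasing HN (Hdiss _ mu_in) (Hdiss _ nu_in)).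
have [c c0 Hc] := norm_lower_bound HN.
apply/subspace_continuousP => mu /=; rewrite in_itv /= => mu_in.
have [alpha Ka Ha] := equilibrium_gap_le HN (Hdiss _ mu_in).
have lo_in : mulo <= mulo <= muhi by lra.
have hi_in : mulo <= muhi <= muhi by lra.
pose D := d mulo - d muhi.
have D_ge0 : 0 <= D by rewrite subr_ge0; apply: d_noninc => //; lra.
have gap nu : mulo <= nu <= muhi -> alpha (N (xe nu - xe mu)) <= `|mu - nu| * D.
  move=> nu_in; apply: le_trans (Ha _ _ _ (Hdiss _ nu_in)) _.
  apply: le_trans (ler_norm _) _; rewrite normrM ler_wpM2l// ler_norml.
  have := d_noninc _ _ lo_in mu_in; have := d_noninc _ _ lo_in nu_in.
  have := d_noninc _ _ mu_in hi_in; have := d_noninc _ _ nu_in hi_in.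
  by rewrite /D /d; lra.
apply/cvgrPdist_lt => e e0.
have ace0 : 0 < alpha (c * e).
  rewrite -(K_infty_zero Ka).
  by apply: (K_infty_increasing Ka) => //; exact: mulr_gt0.
(* The constant [D] may vanish, hence the [D + 1]. *)
pose delta := alpha (c * e) / (D + 1).
have delta0 : 0 < delta by apply: divr_gt0 => //; lra.
rewrite near_withinE; near=> nu => /=; rewrite in_itv /= => nu_in.
have mu_nu : `|mu - nu| < delta.
  by near: nu; apply/nbhs_normP; exists delta.
rewrite distrC ltNge; apply/negP => e_le.
have ce_le : c * e <= N (xe nu - xe mu).
  by apply: le_trans (Hc _); rewrite ler_pM2l.
have : alpha (c * e) <= alpha (N (xe nu - xe mu)).
  move: ce_le; rewrite le_eqVlt => /predU1P[<- //|ce_lt].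
  by apply/ltW/(K_infty_increasing Ka) => //; rewrite ltW// mulr_gt0.
move/le_trans/(_ (gap _ nu_in)); apply/negP; rewrite -ltNge.
have -> : alpha (c * e) = delta * (D + 1) by rewrite divfK//; lra.
apply: (@le_lt_trans _ _ (delta * D)); first by rewrite ler_wpM2r// ltW.
by rewrite ltr_pM2l//; lra.
Unshelve. all: by end_near.
Qed.
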